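(* Let $p$ and $q$ be two distributions on $[k]$ and let $\ell\in\mathbb N$. Let $\mathcal A$ be the set of all pairs of distributions obtained by passing $p$ and $q$ through a channel of output size $\ell$, i.e., $$\mathcal A=\{(\mathbf Tp,\mathbf Tq):\mathbf T\in\mathcal T_{\ell,k}\}.$$ If $\mathbf T\in\mathcal T_{\ell,k}$ and $(\mathbf Tp,\mathbf Tq)$ is an extreme point of $\mathcal A$, then $\mathbf T$ is a threshold channel.
   Context: $[k]=\{1,\dots,k\}$. $\mathcal T_{\ell,k}$ is the set of all channels from $[k]$ to $[\ell]$, i.e. column-stochastic $\ell\times k$ matrices $\mathbf T$; $\mathbf Tp$ is the matrix-vector product, a distribution on $[\ell]$. Threshold channel (with respect to $p,q$): a deterministic channel $\mathbf T\in\mathcal T_{\ell,k}$ (viewed as a map $[k]\to[\ell]$) such that for every $u,v\in[k]$: if $\frac{p(u)}{q(u)}<\frac{p(v)}{q(v)}$ and $\mathbf T(u)=\mathbf T(v)$, then any $w\in[k]$ with $\frac{p(w)}{q(w)}\in\left(\frac{p(u)}{q(u)},\frac{p(v)}{q(v)}\right)$ satisfies $\mathbf T(w)=\mathbf T(u)=\mathbf T(v)$. The likelihood ratios $p(i)/q(i)$ are assumed to take values in the extended real line (equal to $+\infty$ if $q(i)=0\ne p(i)$; thus no $i$ has $p(i)=q(i)=0$). *)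

(* Defs.v *)
From mathcomp Require Import all_boot all_order all_algebra.
From mathcomp Require Import classical_sets reals constructive_ereal.

Set Implicit Arguments.
Unset Strict Implicit.
Unset Printing Implicit Defensive.

Import Order.TTheory GRing.Theory Num.Theory.

Local Open Scope classical_set_scope.
Local Open Scope ring_scope.

Definition is_distribution (R : realType) (k : nat) (p : 'cV[R]_k) : Prop :=
  (forall i, 0 <= p i 0) /\ \sum_(i < k) p i 0 = 1.

Definition channels (R : realType) (l k : nat) : set 'M[R]_(l, k) :=
  [set T | forall j, is_distribution (col j T)].
Arguments channels : clear implicits.

Definition channel_images (R : realType) (l k : nat) (p q : 'cV[R]_k) :
    set ('cV[R]_l * 'cV[R]_l) :=
  [set (T *m p, T *m q) | T in channels R l k].
Arguments channel_images {R} l {k} p q.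

Definition extreme_point (R : realType) (E : lmodType R) (A : set E) (a : E) :
    Prop :=
  A a /\
  forall (x y : E) (t : R), A x -> A y -> 0 < t < 1 ->
    a = t *: x + (1 - t) *: y -> x = a /\ y = a.

(* In [\bar R], [0^-1 = +oo]: the ratio is [+oo] when [q i 0 = 0 < p i 0].
   When [p i 0 = q i 0 = 0] the value is junk. *)
Definition likelihood_ratio (R : realType) (k : nat) (p q : 'cV[R]_k)
    (i : 'I_k) : \bar R :=
  ((p i 0)%:E / (q i 0)%:E)%E.

Definition deterministic_channel (R : realType) (l k : nat)
    (f : 'I_k -> 'I_l) : 'M[R]_(l, k) :=
  \matrix_(i, j) (i == f j)%:R.
Arguments deterministic_channel R {l k} f.

Definition threshold_channel (R : realType) (l k : nat) (p q : 'cV[R]_k)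
    (T : 'M[R]_(l, k)) : Prop :=
  exists2 f : 'I_k -> 'I_l, T = deterministic_channel R f &
    forall u v : 'I_k,
      (likelihood_ratio p q u < likelihood_ratio p q v)%E -> f u = f v ->
      forall w : 'I_k,
        (likelihood_ratio p q u < likelihood_ratio p q w)%E ->
        (likelihood_ratio p q w < likelihood_ratio p q v)%E ->
        f w = f u.

(* Main.v *)
Require Import Defs.
From mathcomp Require Import all_boot all_order all_algebra.
From mathcomp Require Import classical_sets reals constructive_ereal.
From mathcomp Require Import ring lra.

(** Write [x_i = (p_i, q_i)], a nonzero vector.  If a channel [T] has two
    positive entries in column [j], rows [a] and [b], then moving a little mass
    of column [j] between [a] and [b] in either direction changes [(Tp, Tq)] by
    a nonzero vector and its opposite, so no channel realizing an extreme point
    has such a column.  Suppose now that a deterministic [T] sends [u] and [v]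
    to [a] but an intermediate [w] to [b <> a].  Then
    [x_w = alpha x_u + beta x_v] with [alpha, beta > 0], so moving a small
    fraction [c] of [w] to [a], and in exchange fractions [c alpha] of [u] and
    [c beta] of [v] to [b], leaves [(Tp, Tq)] unchanged while splitting column
    [w], which is excluded by the first part. *)

Set Implicit Arguments.
Unset Strict Implicit.
Unset Printing Implicit Defensive.

Import Order.TTheory GRing.Theory Num.Theory.

Local Open Scope ring_scope.

Lemma channelP (R : realType) (l k : nat) (T : 'M[R]_(l, k)) :
  channels R l k T <->
  (forall i j, 0 <= T i j) /\ (forall j, \sum_i T i j = 1).
Proof.
split=> [hT|[T0 T1] j].
  split=> [i j|j]; have [h0 h1] := hT j.
    by have := h0 i; rewrite mxE.
  by rewrite -h1; apply: eq_bigr => i _; rewrite mxE.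
split=> [i|]; first by rewrite mxE.
by rewrite -(T1 j); apply: eq_bigr => i _; rewrite mxE.
Qed.

(** In column [j], mass [d 0 j] moves from row [b] to row [a], or back if negative. In this rank-one
    form the effect on [x] depends only on the scalar [d *m x]. *)
Definition transfer (R : realType) (l k : nat) (a b : 'I_l) (d : 'rV[R]_k) :
    'M[R]_(l, k) :=
  (delta_mx a 0 - delta_mx b 0 : 'cV[R]_l) *m d.
Arguments transfer {R l k} a b d.

Lemma transferE (R : realType) (l k : nat) (a b i : 'I_l) (d : 'rV[R]_k)
    (j : 'I_k) :
  transfer a b d i j = ((i == a)%:R - (i == b)%:R) * d 0 j.
Proof. by rewrite /transfer mxE big_ord1 !mxE !eqxx !andbT. Qed.

Lemma transfer_mul (R : realType) (l k : nat) (a b : 'I_l) (d : 'rV[R]_k)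
    (x : 'cV[R]_k) (i : 'I_l) :
  (transfer a b d *m x) i 0 = ((i == a)%:R - (i == b)%:R) * (d *m x) 0 0.
Proof. by rewrite /transfer -mulmxA -/(transfer a b (d *m x)) transferE. Qed.

(** Column sums are preserved, and the two bounds on [d] keep rows [a] and [b] nonnegative. *)
Lemma channel_transfer (R : realType) (l k : nat) (a b : 'I_l) (d : 'rV[R]_k)
    (T : 'M[R]_(l, k)) :
  a != b -> channels R l k T ->
  (forall j, - T a j <= d 0 j <= T b j) ->
  channels R l k (T + transfer a b d).
Proof.
move=> ab /channelP[T0 T1] hd; apply/channelP; split=> [i j|j].
  rewrite mxE transferE; have /andP[ha hb] := hd j.
  case: (eqVneq i a) => [->|_]; first by rewrite (negbTE ab) /=; lra.
  case: (eqVneq i b) => [->|_] /=; first by lra.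
  by rewrite subrr mul0r addr0.
have sum1 c : \sum_(i < l) (i == c)%:R = 1 :> R.
  by rewrite (bigD1 c) //= eqxx big1 ?addr0 // => i /negbTE ->.
under eq_bigr do rewrite mxE transferE.
by rewrite big_split /= T1 -mulr_suml sumrB !sum1 subrr mul0r addr0.
Qed.

(** Stated for any channel realizing the extreme pair, since it is applied both to the given channel
    and to a modified one. *)
Lemma extreme_column_unsplit (R : realType) (l k : nat) (p q : 'cV[R]_k)
    (T : 'M[R]_(l, k)) (a b : 'I_l) (j : 'I_k) :
  ~ (p j 0 = 0 /\ q j 0 = 0) -> channels R l k T ->
  extreme_point (channel_images l p q) (T *m p, T *m q) ->
  0 < T a j -> 0 < T b j -> a = b.
Proof.
move=> pq0 hT [_ hext] Ta Tb; apply/eqP/negPn/negP => ab.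
have /channelP[T0 _] := hT.
(* The largest mass that can move in both directions. *)
pose e := Num.min (T a j) (T b j).
have e0 : 0 < e by rewrite lt_min Ta.
have ea : e <= T a j by rewrite ge_min lexx.
have eb : e <= T b j by rewrite ge_min lexx orbT.
pose d : 'rV[R]_k := e *: delta_mx 0 j.
have hd j' : d 0 j' = e * (j' == j)%:R by rewrite !mxE eqxx.
have hch s : -1 <= s <= 1 -> channels R l k (T + transfer a b (s *: d)).
  move=> /andP[s1 s2]; apply: channel_transfer => // j'.
  rewrite mxE hd; case: (eqVneq j' j) => [->|_]; last first.
    by have := T0 a j'; have := T0 b j'; rewrite !mulr0 oppr_le0 => -> ->.
  by rewrite mulr1; apply/andP; split; nra.
have dot (x : 'cV[R]_k) : (d *m x) 0 0 = e * x j 0.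
  by rewrite /d -scalemxAl mxE -rowE mxE.
have mid (x : 'cV[R]_k) :
    T *m x = 2^-1 *: ((T + transfer a b (1 *: d)) *m x) +
             (1 - 2^-1) *: ((T + transfer a b (-1 *: d)) *m x).
  rewrite scale1r scaleN1r /transfer mulmxN -/(transfer a b d).
  rewrite !mulmxDl mulNmx; set y := T *m x; set z := _ *m x.
  by apply/colP => i; rewrite !mxE; field.
have im s : -1 <= s <= 1 -> channel_images l p q
    ((T + transfer a b (s *: d)) *m p, (T + transfer a b (s *: d)) *m q).
  by move=> hs; exists (T + transfer a b (s *: d)) => //; exact: hch.
have [||||[hp hq] _] := hext _ _ 2^-1 (im 1 _) (im (-1) _) _ _.
- by lra.
- by lra.
- by lra.
- by congr pair; exact: mid.
(* Row [a] of the image changes by [e * x j 0], which must vanish. *)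
have fixed0 (x : 'cV[R]_k) : (T + transfer a b (1 *: d)) *m x = T *m x -> x j 0 = 0.
  rewrite mulmxDl => /colP/(_ a); rewrite mxE transfer_mul scale1r dot eqxx.
  rewrite (negbTE ab) subr0 mul1r => h.
  have /eqP : e * x j 0 = 0 by lra.
  by rewrite mulf_eq0 (gt_eqF e0) => /eqP.
by apply: pq0; split; apply: fixed0.
Qed.

Lemma channel_deterministic (R : realType) (l k : nat) (T : 'M[R]_(l, k)) :
  channels R l k T ->
  (forall a b j, 0 < T a j -> 0 < T b j -> a = b) ->
  exists f : 'I_k -> 'I_l, T = deterministic_channel R f.
Proof.
move=> /channelP[T0 T1] Tuniq.
have /fin_all_exists[f hf] : forall j, exists i, 0 < T i j.
  move=> j; apply/existsP; apply: contraT => /existsPn Tn.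
  have := T1 j; rewrite big1 => [|i _]; last first.
    by apply/eqP; rewrite eq_le T0 andbT leNgt.
  by move/eqP; rewrite eq_sym oner_eq0.
have off i j : i != f j -> T i j = 0.
  move=> ij; apply/eqP; rewrite eq_le T0 andbT leNgt.
  by apply: contra ij => Tij; apply/eqP; exact: Tuniq Tij (hf j).
exists f; apply/matrixP => i j; rewrite mxE.
case: (eqVneq i (f j)) => [->|/off //].
by rewrite -(T1 j) (bigD1 (f j)) //= big1 ?addr0 // => i' /off.
Qed.

(** Cross-multiplication also covers infinite ratios: [q i 0 = 0] would make the smaller ratio
    [+oo], and [q j 0 = 0] makes the left product zero and the right one positive. *)
Lemma likelihood_ratio_lt (R : realType) (k : nat) (p q : 'cV[R]_k)
    (i j : 'I_k) :
  0 <= p i 0 -> 0 <= p j 0 -> 0 <= q i 0 -> 0 <= q j 0 ->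
  ~ (p i 0 = 0 /\ q i 0 = 0) -> ~ (p j 0 = 0 /\ q j 0 = 0) ->
  (likelihood_ratio p q i < likelihood_ratio p q j)%E ->
  p i 0 * q j 0 < p j 0 * q i 0.
Proof.
rewrite /likelihood_ratio !inver => pi0 pj0 qi0 qj0 hi hj.
case: (eqVneq (q i 0) 0) => [qi|qi].
  have pi : 0 < p i 0 by rewrite lt_def pi0 andbT; apply/eqP => pi; apply: hi.
  by rewrite gt0_muley ?lte_fin // ltNge leey.
have qi' : 0 < q i 0 by rewrite lt_def qi.
case: (eqVneq (q j 0) 0) => [qj|qj].
  have pj : 0 < p j 0 by rewrite lt_def pj0 andbT; apply/eqP => pj; apply: hj.
  by rewrite qj mulr0 mulr_gt0.
have qj' : 0 < q j 0 by rewrite lt_def qj.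
by rewrite -!EFinM lte_fin ltr_pdivrMr // mulrAC ltr_pdivlMr.
Qed.

Theorem theorem1p16 (R : realType) (k l : nat) (p q : 'cV[R]_k)
    (hp : is_distribution p) (hq : is_distribution q)
    (hpq : forall i : 'I_k, ~ (p i 0 = 0 /\ q i 0 = 0))
    (T : 'M[R]_(l, k)) (hT : channels R l k T)
    (hext : extreme_point (channel_images l p q) (T *m p, T *m q)) :
  threshold_channel p q T.
Proof.
have [p0 _] := hp; have [q0 _] := hq.
have [|f hf] := channel_deterministic hT.
  by move=> a b j; exact: extreme_column_unsplit (hpq j) hT hext.
exists f => // u v ruv fuv w ruw rwv; apply/eqP/negPn/negP => fwu.
have lt_cross i j : (likelihood_ratio p q i < likelihood_ratio p q j)%E ->
    p i 0 * q j 0 < p j 0 * q i 0.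
  by apply: likelihood_ratio_lt.
have uw : u != w by apply: contraTneq ruw => ->; rewrite ltxx.
have vw : v != w by apply: contraTneq rwv => ->; rewrite ltxx.
have uv : u != v by apply: contraTneq ruv => ->; rewrite ltxx.
(* Cramer's rule in homogeneous form: [g x_w = al x_u + be x_v]. *)
pose al := p v 0 * q w 0 - p w 0 * q v 0.
pose be := p w 0 * q u 0 - p u 0 * q w 0.
pose g := p v 0 * q u 0 - p u 0 * q v 0.
have al0 : 0 < al by rewrite subr_gt0 lt_cross.
have be0 : 0 < be by rewrite subr_gt0 lt_cross.
have g0 : 0 < g by rewrite subr_gt0 lt_cross.
(* This scale puts [c * al], [c * be] and [c * g] strictly between 0 and 1, so no unit entry of [T]
   is exhausted. *)
pose c := (al + be + g + g)^-1.
have c0 : 0 < c by rewrite invr_gt0; lra.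
have cE : c * (al + be + g + g) = 1 by rewrite mulVf ?gt_eqF //; lra.
pose d : 'rV[R]_k := c *: (g *: delta_mx 0 w - al *: delta_mx 0 u
                           - be *: delta_mx 0 v).
have hd j : d 0 j =
    c * (g * (j == w)%:R - al * (j == u)%:R - be * (j == v)%:R).
  by rewrite !mxE !eqxx.
have dot (x : 'cV[R]_k) : g * x w 0 = al * x u 0 + be * x v 0 -> d *m x = 0.
  move=> xw; apply/matrixP => i i'; rewrite !ord1 /d -scalemxAl !mulmxBl.
  rewrite -!scalemxAl -!rowE !mxE xw; ring.
pose T' := T + transfer (f u) (f w) d.
have T'x (x : 'cV[R]_k) :
    g * x w 0 = al * x u 0 + be * x v 0 -> T' *m x = T *m x.
  by move=> /dot xw; rewrite /T' mulmxDl /transfer -mulmxA xw mulmx0 addr0.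
(* The relation for [x] is the vanishing of a 3 by 3 determinant with rows [p], [q], [x], two of
   which coincide. *)
have T'p : T' *m p = T *m p by apply: T'x; rewrite /g /al /be; ring.
have T'q : T' *m q = T *m q by apply: T'x; rewrite /g /al /be; ring.
have cal : 0 < c * al by rewrite mulr_gt0.
have cbe : 0 < c * be by rewrite mulr_gt0.
have cg : 0 < c * g by rewrite mulr_gt0.
have uw' : f u != f w by rewrite eq_sym.
have hT' : channels R l k T'.
  apply: channel_transfer => // j; rewrite hd hf !mxE.
  case: (eqVneq j w) => [->|jw].
    rewrite ![w == _]eq_sym (negbTE uw) (negbTE vw) (negbTE uw') eqxx /=.
    by apply/andP; split; lra.
  case: (eqVneq j u) => [->|ju].
    rewrite (negbTE uv) eqxx (negbTE fwu) /=; apply/andP; split; lra.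
  case: (eqVneq j v) => [->|jv].
    by rewrite -fuv eqxx (negbTE fwu) /=; apply/andP; split; lra.
  rewrite !mulr0 !subr0 mulr0 oppr_le0; apply/andP; split; exact: ler0n.
suff : f u = f w by apply/eqP.
(* Column [w] of [T'] holds [c * g] in row [f u] and [1 - c * g] in row [f w], both positive. *)
apply: (extreme_column_unsplit (hpq w) hT').
- by rewrite T'p T'q.
- rewrite mxE transferE hd hf !mxE !eqxx ![w == _]eq_sym (negbTE uw).
  rewrite (negbTE vw) (negbTE uw') /=; lra.
- rewrite mxE transferE hd hf !mxE !eqxx ![w == _]eq_sym (negbTE uw).
  rewrite (negbTE vw) (negbTE fwu) /=; lra.
Qed.
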